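(* Let $\mathcal A$ be a finite alphabet, let $\Phi:\mathcal A^{\mathbb Z}\to\mathcal A^{\mathbb Z}$ be a nearest-neighbour cellular automaton, and let $\mathbf X\subset\mathcal A^{\mathbb Z}$ be a Markov subshift with $\Phi(\mathbf X)\subseteq\mathbf X$. Let $\mathbf L,\mathbf R\subset\mathbf X$ be subshifts which are $\sigma$-periodic and $(\sigma,\Phi)$-transitive. Let $W\in\mathbb N$, $\ell:=\lceil W/2\rceil-1$, $m:=\lfloor W/2\rfloor$, and let $\mathbf D^W_{\mathbf L,\mathbf R}$ be the set of all sequences in $\mathcal A^{\mathbb Z}$ with a single $(\mathbf L,\mathbf R)$ defect particle of width $W$ (relative to $\mathbf X$). Then the dynamical system $(\mathbf D^W_{\mathbf L,\mathbf R},\Phi)$ is isomorphic to a dynamical system $(\mathcal X\times\mathbb Z,\Xi)$, where $\mathcal X$ is a finite set and $\Xi:\mathcal X\times\mathbb Z\to\mathcal X\times\mathbb Z$ is defined by $$\Xi(x,z):=\bigl(\xi(x),\,z+V(x)\bigr)$$ for some functions $\xi:\mathcal X\to\mathcal X$ and $V:\mathcal X\to\{-\ell-2,\dots,m+1\}$. That is, there is a bijection $\Psi:\mathcal X\times\mathbb Z\to\mathbf D^W_{\mathbf L,\mathbf R}$ with $\Phi\circ\Psi=\Psi\circ\Xi$.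
   Context: $\mathbb N=\{0,1,2,\dots\}$; $\sigma$ is the shift on $\mathcal A^{\mathbb Z}$, $\sigma(\mathbf a)_z=a_{z+1}$. A nearest-neighbour cellular automaton has the form $\Phi(\mathbf a)_z=\phi(a_{z-1},a_z,a_{z+1})$ with $\phi:\mathcal A^{\{-1,0,1\}}\to\mathcal A$. A subshift is a closed subset $\mathbf S\subset\mathcal A^{\mathbb Z}$ with $\sigma(\mathbf S)=\mathbf S$; $\mathbf S_2$ is the set of words of length 2 occurring in elements of $\mathbf S$; $\mathbf S$ is Markov if $\mathbf S=\{\mathbf s:(s_z,s_{z+1})\in\mathbf S_2\ \forall z\}$. A subshift $\mathbf L$ is $\sigma$-periodic if there is $P\ge1$ with $\sigma^P(\mathbf l)=\mathbf l$ for all $\mathbf l\in\mathbf L$. A $\Phi$-invariant subshift $\mathbf L$ (i.e. $\Phi(\mathbf L)\subseteq\mathbf L$) is $(\sigma,\Phi)$-transitive if some $\mathbf x\in\mathbf L$ has dense joint orbit $\{\Phi^n\sigma^k(\mathbf x):n\in\mathbb N,k\in\mathbb Z\}$ in $\mathbf L$. For a subshift $\mathbf S$, $\mathbf S^-$ (resp. $\mathbf S^+$) is the set of left-infinite (resp. right-infinite) sequences obtained by restricting elements of $\mathbf S$ to a left (resp. right) half-line; we identify sequences on different half-lines by translation. Single defect (relative to $\mathbf X$): $\mathbf a$ has a single defect in $[i\ldots k]$, $i\le k$, if $(a_j,a_{j+1})\in\mathbf X_2$ for all $j\notin[i\ldots k]$ and $(a_j,a_{j+1})\notin\mathbf X_2$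 for all $j\in[i\ldots k]$. Its width is $w:=k-i$, left radius $L:=\lceil w/2\rceil-1$, right radius $R:=\lfloor w/2\rfloor$, centre $z:=i+L+1$. $\mathbf D^W_{\mathbf L,\mathbf R}$ is the set of all $\mathbf a\in\mathcal A^{\mathbb Z}$ such that for every $t\in\mathbb N$, $\mathbf a^t:=\Phi^t(\mathbf a)$ has a single defect, with centre $z_t$, left radius $L_t\le\ell$ and right radius $R_t\le m$, and such that the left-infinite sequence $(a^t_j)_{j\le z_t-\ell-1}$ lies in $\mathbf L^-$ and the right-infinite sequence $(a^t_j)_{j\ge z_t+m+1}$ lies in $\mathbf R^+$. (So $\Phi(\mathbf D^W_{\mathbf L,\mathbf R})\subseteq\mathbf D^W_{\mathbf L,\mathbf R}$.) *)

(* Defs.v *)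
From HB Require Import structures.
From mathcomp Require Import all_boot all_order all_algebra.
From mathcomp Require Import all_classical topology.

Set Implicit Arguments.
Unset Strict Implicit.
Unset Printing Implicit Defensive.

Import Order.TTheory GRing.Theory Num.Theory.
Local Open Scope classical_set_scope.
Local Open Scope ring_scope.

(* Bi-infinite sequences over A, with the product of the discrete topologies. *)
Definition config (A : finType) : Type := {ptws int -> discrete_topology A}.
HB.instance Definition _ (A : finType) := Topological.on (config A).

Section Subshifts.
Variable A : finType.
Implicit Types (a s : config A) (S X L R : set (config A)).
Implicit Types (Phi : config A -> config A).

Definition sigmaz (k : int) a : config A := fun z => a (z + k).
Definition sigma a : config A := sigmaz 1 a.

Lemma iter_sigma n a : iter n sigma a = sigmaz n%:Z a.
Proof.
elim: n => [|n IH] /=; apply/funext => z; rewrite /sigma /sigmaz ?addr0//.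
by rewrite IH /sigmaz -addrA intS.
Qed.

Lemma iter_sigmaN n a : iter n sigma (sigmaz (- n%:Z) a) = a.
Proof. by rewrite iter_sigma; apply/funext => z; rewrite /sigmaz addrK. Qed.

Definition nearest_neighbour_ca Phi :=
  exists phi : A -> A -> A -> A,
    forall a z, Phi a z = phi (a (z - 1)) (a z) (a (z + 1)).

Definition subshift S := closed S /\ sigma @` S = S.

Definition words2 S : set (A * A) :=
  [set w | exists2 s, S s & exists z : int, w = (s z, s (z + 1))].

Definition markov_subshift S :=
  S = [set s | forall z : int, words2 S (s z, s (z + 1))].

Definition ca_invariant Phi S := Phi @` S `<=` S.

Definition sigma_periodic S :=
  exists2 P : nat, (1 <= P)%N & forall s, S s -> iter P sigma s = s.

Definition joint_orbit Phi x : set (config A) :=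
  [set y | exists (n : nat) (k : int), y = iter n Phi (sigmaz k x)].

(* By invariance the joint orbit lies in S, so density in S only asks that its
   closure contain S. *)
Definition sigma_transitive Phi S :=
  ca_invariant Phi S /\ exists2 x, S x & S `<=` closure (joint_orbit Phi x).

(* Half-infinite sequences are indexed by the distance to their end point; this
   identifies sequences living on translated half-lines. *)
Definition left_from a (p : int) : nat -> A := fun n => a (p - n%:Z).
Definition right_from a (p : int) : nat -> A := fun n => a (p + n%:Z).

Definition left_part S : set (nat -> A) :=
  [set u | exists2 s, S s & exists p, u = left_from s p].
Definition right_part S : set (nat -> A) :=
  [set u | exists2 s, S s & exists p, u = right_from s p].

Definition single_defect X a (i k : int) :=
  [/\ i <= k,
      forall j : int, ~~ (i <= j <= k) -> words2 X (a j, a (j + 1)) &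
      forall j : int, i <= j <= k -> ~ words2 X (a j, a (j + 1))].

End Subshifts.

(* The radii are integers: a defect of width 0 has left radius -1. *)
Definition left_radius (w : nat) : int := (uphalf w)%:Z - 1.
Definition right_radius (w : nat) : int := (w./2)%:Z.

Definition defect_width (i k : int) : nat := `|k - i|%N.
Definition defect_centre (i k : int) : int :=
  i + left_radius (defect_width i k) + 1.

Definition defect_particles (A : finType) (Phi : config A -> config A)
    (X L R : set (config A)) (W : nat) : set (config A) :=
  [set a | forall t : nat, exists i k : int,
    let at_ := iter t Phi a in
    let z := defect_centre i k in
    [/\ single_defect X at_ i k,
        left_radius (defect_width i k) <= left_radius W,
        right_radius (defect_width i k) <= right_radius W,
        left_part L (left_from at_ (z - left_radius W - 1)) &
        right_part R (right_from at_ (z + right_radius W + 1))]].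

Definition skew_translation (T : Type) (xi : T -> T) (V : T -> int)
  (p : T * int) : T * int := (xi p.1, p.2 + V p.1).

(* Main.v *)
(** Since [Phi] commutes with the shift and the centre of a defect is
    equivariant under it, a particle is determined by its centre together with
    its translate centred at 0.  The [sigma]-periodicity of [L] and [R] makes
    the set of centred particles finite, and the displacement [V] of the centre
    is bounded because [Phi] sends a window of admissible words to an admissible
    word, so that the defect interval grows by at most one site on each side. *)

Require Import Defs.
From HB Require Import structures.
From mathcomp Require Import all_boot all_order all_algebra.
From mathcomp Require Import all_classical topology.
From mathcomp Require Import zify.

Set Implicit Arguments.
Unset Strict Implicit.
Unset Printing Implicit Defensive.

Import Order.TTheory GRing.Theory Num.Theory.
Local Open Scope classical_set_scope.
Local Open Scope ring_scope.

(** * Arithmetic of defect intervals and their centres *)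

Lemma defect_centreB (i k c : int) :
  defect_centre (i - c) (k - c) = defect_centre i k - c.
Proof.
rewrite /defect_centre /defect_width.
have -> : k - c - (i - c) = k - i by lia.
by rewrite -!addrA [- c + _]addrC !addrA.
Qed.

Lemma defect_centre_bounds (i k : int) : i <= k -> i <= defect_centre i k <= k.
Proof. rewrite /defect_centre /defect_width /left_radius => ik; lia. Qed.

Lemma defect_centre_left (i k : int) :
  i = defect_centre i k - left_radius (defect_width i k) - 1.
Proof. by rewrite /defect_centre; lia. Qed.

Lemma defect_centre_right (i k : int) :
  i <= k -> k = defect_centre i k + right_radius (defect_width i k).
Proof.
rewrite /defect_centre /defect_width /left_radius /right_radius => ik; lia.
Qed.

Lemma eq_periodic (T : Type) (P : nat) (u v : nat -> T) : (0 < P)%N ->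
  (forall n, u (n + P)%N = u n) -> (forall n, v (n + P)%N = v n) ->
  (forall n, (n < P)%N -> u n = v n) -> u = v.
Proof.
move=> P0 uP vP uv; apply/funext => n.
have per (w : nat -> T) : (forall n, w (n + P)%N = w n) ->
    forall q r, w (q * P + r)%N = w r.
  by move=> wP; elim=> [//|q IH] r; rewrite mulSn -addnA addnC wP IH.
by rewrite (divn_eq n P) !per// uv// ltn_mod.
Qed.

(** * Shift equivariance and periodicity of half-lines *)

Section Shifts.
Variable A : finType.
Implicit Types (a s : config A) (S X : set (config A)).
Implicit Types (Phi : config A -> config A).

Lemma sigmaz0 a : sigmaz 0 a = a.
Proof. by apply/funext => z; rewrite /sigmaz addr0. Qed.

Lemma sigmazD k j a : sigmaz k (sigmaz j a) = sigmaz (k + j) a.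
Proof. by apply/funext => z; rewrite /sigmaz addrA. Qed.

Lemma ca_sigmaz Phi k a :
  nearest_neighbour_ca Phi -> Phi (sigmaz k a) = sigmaz k (Phi a).
Proof.
move=> [phi phiE]; apply/funext => z; rewrite /sigmaz !phiE.
by congr phi; congr a; lia.
Qed.

Lemma iter_ca_sigmaz Phi t k a : nearest_neighbour_ca Phi ->
  iter t Phi (sigmaz k a) = sigmaz k (iter t Phi a).
Proof. by move=> hPhi; elim: t => //= t ->; exact: ca_sigmaz. Qed.

Lemma left_from_sigmaz k a p : left_from (sigmaz k a) p = left_from a (p + k).
Proof. by apply/funext => n; rewrite /left_from /sigmaz; congr a; lia. Qed.

Lemma right_from_sigmaz k a p :
  right_from (sigmaz k a) p = right_from a (p + k).
Proof. by apply/funext => n; rewrite /right_from /sigmaz; congr a; lia. Qed.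

Lemma left_part_periodic S P u :
  (forall s, S s -> iter P (@sigma A) s = s) -> left_part S u ->
  forall n, u (n + P)%N = u n.
Proof.
(* [left_from] reads leftwards, so the period is inserted on the side with index [n + P]; for right
   half-lines it is the other side. *)
move=> SP [s Ss [p ->]] n; rewrite /left_from -[in LHS](SP _ Ss) iter_sigma.
by rewrite /sigmaz; congr s; lia.
Qed.

Lemma right_part_periodic S P u :
  (forall s, S s -> iter P (@sigma A) s = s) -> right_part S u ->
  forall n, u (n + P)%N = u n.
Proof.
move=> SP [s Ss [p ->]] n; rewrite /right_from -[in RHS](SP _ Ss) iter_sigma.
by rewrite /sigmaz; congr s; lia.
Qed.

(** * Position of a defect and its propagation under [Phi] *)

Lemma single_defect_sigmaz X a i k c : single_defect X a i k ->
  single_defect X (sigmaz c a) (i - c) (k - c).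
Proof.
case=> ik good bad; split=> [|j hj|j hj]; first by lia.
- rewrite /sigmaz (_ : j + 1 + c = j + c + 1); last by lia.
  by apply: good; lia.
- rewrite /sigmaz (_ : j + 1 + c = j + c + 1); last by lia.
  by apply: bad; lia.
Qed.

(** The interval is exactly the set of sites carrying a forbidden word, and a non-empty interval
    determines its ends. *)
Lemma single_defect_uniq X a i k i' k' :
  single_defect X a i k -> single_defect X a i' k' -> i = i' /\ k = k'.
Proof.
move=> [ik good bad] [ik' good' bad'].
have sub j : (i <= j <= k) = (i' <= j <= k').
  apply/idP/idP => h; apply/negPn/negP => h'.
    exact: bad h (good' _ h').
  exact: bad' h (good _ h').
by move: (sub i) (sub k) (sub i') (sub k'); lia.
Qed.

(* The left tail of a point of [X] containing the first word and the right tail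
   of one containing the last word glue along the window to a point of [X]. *)
Lemma markov_glue3 X a j : markov_subshift X ->
  (forall d : int, -1 <= d <= 1 -> words2 X (a (j + d), a (j + d + 1))) ->
  exists2 s, X s & forall d : int, -1 <= d <= 2 -> s d = a (j + d).
Proof.
move=> XM h.
have [s1 X1 [z1 [e1 e1']]] := h (-1) isT.
have [s2 X2 [z2 [e2 e2']]] := h 1 isT.
(* The offsets put [z1] at position -1 and [z2] at position 1, so every pair of neighbours in [s]
   lies in [s1], in the window or in [s2]. *)
pose s : config A := fun d => if d <= -1 then s1 (z1 + d + 1)
  else if d <= 1 then a (j + d) else s2 (z2 + d - 1).
have sE (d : int) : -1 <= d <= 2 -> s d = a (j + d).
  move=> hd; rewrite /s; case: ifPn => h1.
    have -> : d = -1 by lia.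
    by rewrite e1; congr s1; lia.
  case: ifPn => // h2.
  have -> : d = 2 by lia.
  by rewrite (_ : j + 2 = j + 1 + 1) ?e2'; [congr s2; lia | lia].
exists s => //; rewrite XM => d /=.
have [hd|hd] := boolP (-1 <= d <= 1).
  by rewrite !sE ?addrA; [exact: h | lia | lia].
have [d1|d1] := boolP (d <= -2).
  exists s1 => //; exists (z1 + d + 1).
  by rewrite /s !ifT; [congr (_, s1 _); lia | lia | lia].
exists s2 => //; exists (z2 + d - 1).
by rewrite /s !ifF; [congr (_, s2 _); lia | lia ..].
Qed.

(** The two image letters depend only on the sites [j - 1] to [j + 2], where [a] agrees with a
    translate of a point of [X], and [Phi] keeps that point in [X]. *)
Lemma ca_words2 Phi X a j : nearest_neighbour_ca Phi -> markov_subshift X ->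
  ca_invariant Phi X ->
  (forall d : int, -1 <= d <= 1 -> words2 X (a (j + d), a (j + d + 1))) ->
  words2 X (Phi a j, Phi a (j + 1)).
Proof.
move=> [phi phiE] XM XPhi /(markov_glue3 XM)[s Xs sE].
exists (Phi s); first by apply: XPhi; exists s.
exists 0; rewrite !phiE !sE//.
by congr (phi _ _ _, phi _ _ _); congr a; lia.
Qed.

(** By contraposition of [ca_words2], a forbidden word of [Phi a] at [j] requires one of [a] at
    [j - 1], [j] or [j + 1]. *)
Lemma single_defect_ca Phi X a i k i' k' :
  nearest_neighbour_ca Phi -> markov_subshift X -> ca_invariant Phi X ->
  single_defect X a i k -> single_defect X (Phi a) i' k' ->
  i - 1 <= i' /\ k' <= k + 1.
Proof.
move=> hPhi XM XPhi [ik good bad] [ik' good' bad'].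
have sub j : i' <= j <= k' -> i - 1 <= j <= k + 1.
  move=> h; apply/negPn/negP => h'; apply: (bad' _ h).
  by apply: ca_words2 => // d hd; apply: good; lia.
by move: (sub i') (sub k'); lia.
Qed.

(** * Defect particles and the motion of their centre *)

Lemma defect_particles_sigmaz Phi X L R W k a : nearest_neighbour_ca Phi ->
  defect_particles Phi X L R W a -> defect_particles Phi X L R W (sigmaz k a).
Proof.
move=> hPhi Da t; have [i [j [sd hl hr La Ra]]] := Da t.
exists (i - k), (j - k); rewrite /= iter_ca_sigmaz// defect_centreB.
rewrite left_from_sigmaz right_from_sigmaz /defect_width.
rewrite (_ : j - k - (i - k) = j - i); last by lia.
split=> //; first exact: single_defect_sigmaz.
- by rewrite (_ : _ + k = defect_centre i j - left_radius W - 1) //; lia.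
- by rewrite (_ : _ + k = defect_centre i j + right_radius W + 1) //; lia.
Qed.

Lemma defect_particles_ca Phi X L R W a :
  defect_particles Phi X L R W a -> defect_particles Phi X L R W (Phi a).
Proof. by move=> Da t; have := Da t.+1; rewrite iterSr. Qed.

Definition is_centre X a : set int :=
  [set c | exists i k, single_defect X a i k /\ c = defect_centre i k].

(** Made total by the default 0, which is reached only when [a] has no single defect. *)
Definition centre X a : int := xget 0 (is_centre X a).

Lemma centreE X a i k : single_defect X a i k -> centre X a = defect_centre i k.
Proof.
move=> sd; rewrite /centre; case: xgetP => [_ _ [i' [k' [sd' ->]]]|no].
  by have [-> ->] := single_defect_uniq sd sd'.
by case: (no (defect_centre i k)); exists i, k.
Qed.

(** The new centre lies in the new interval, hence in [[i - 1, k + 1]]. Since [i] is the old centre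
    minus its left radius minus 1, and [k] the old centre plus its right radius, the bounds are
    asymmetric. *)
Lemma centre_ca_bounds Phi X L R W a :
  nearest_neighbour_ca Phi -> markov_subshift X -> ca_invariant Phi X ->
  defect_particles Phi X L R W a ->
  - left_radius W - 2 <= centre X (Phi a) - centre X a <= right_radius W + 1.
Proof.
move=> hPhi XM XPhi Da.
have [i [k [sd hl hr _ _]]] := Da 0; have [i' [k' [sd' _ _ _ _]]] := Da 1.
have [hi hk] := single_defect_ca hPhi XM XPhi sd sd'.
rewrite (centreE sd) (centreE sd').
have [[ik _ _] [ik' _ _]] := (sd, sd').
move: (defect_centre_bounds ik') (defect_centre_left i k).
by move: (defect_centre_right ik) hl hr => /=; lia.
Qed.

(* A centred particle is periodic outside the window of the defect, hence
   determined by its values on a window larger by one period on each side. *)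
Lemma centred_particle_eq Phi X L R W P a b : (0 < P)%N ->
  (forall s, L s -> iter P (@sigma A) s = s) ->
  (forall s, R s -> iter P (@sigma A) s = s) ->
  defect_particles Phi X L R W a -> centre X a = 0 ->
  defect_particles Phi X L R W b -> centre X b = 0 ->
  (forall j : int, (`|j| <= W + P)%N -> a j = b j) -> a = b.
Proof.
move=> P0 LP RP Da ca Db cb ab.
have [i [k [sd _ _]]] := Da 0; have [i' [k' [sd' _ _]]] := Db 0.
rewrite -(centreE sd) -(centreE sd') ca cb /= => Lb Rb La Ra.
have lab : left_from a (0 - left_radius W - 1) =
    left_from b (0 - left_radius W - 1).
  apply: (eq_periodic P0) => [||n nP]; try exact: left_part_periodic LP _.
  (* For [n < P] the site is at distance at most [uphalf W + P - 1] from 0. *)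
  by apply: ab; rewrite /left_radius; lia.
have rab : right_from a (0 + right_radius W + 1) =
    right_from b (0 + right_radius W + 1).
  apply: (eq_periodic P0) => [||n nP]; try exact: right_part_periodic RP _.
  by apply: ab; rewrite /right_radius; lia.
apply/funext => j.
have [jl|jl] := boolP (j <= 0 - left_radius W - 1).
  have := congr1 (@^~ (absz (0 - left_radius W - 1 - j)%R)) lab.
  by rewrite /left_from (_ : _ - _%:Z = j) //; lia.
have [jr|jr] := boolP (0 + right_radius W + 1 <= j).
  have := congr1 (@^~ (absz (j - (0 + right_radius W + 1))%R)) rab.
  by rewrite /right_from (_ : _ + _%:Z = j) //; lia.
by apply: ab; move: jl jr; rewrite /left_radius /right_radius; lia.
Qed.

(** * Conjugacy with a skew translation *)

(** The shift acts freely on [D] and [c] picks one centred point in each orbit; the code [r] embeds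
    these points into a finite type. *)
Lemma skew_translation_conjugacy Phi (D : set (config A)) (c : config A -> int)
    (V0 : set int) (F : finType) (r : config A -> F) :
  (forall k a, Phi (sigmaz k a) = sigmaz k (Phi a)) ->
  (forall a, D a -> D (Phi a)) ->
  (forall k a, D a -> D (sigmaz k a)) ->
  (forall k a, D a -> c (sigmaz k a) = c a - k) ->
  (forall a, D a -> V0 (c (Phi a) - c a)) ->
  (forall a b, D a -> c a = 0 -> D b -> c b = 0 -> r a = r b -> a = b) ->
  exists (T : finType) (xi : T -> T) (V : T -> int),
    (forall x, V0 (V x)) /\
    exists Psi : T * int -> config A,
      set_bij [set: T * int] D Psi /\
      forall p, Phi (Psi p) = Psi (skew_translation xi V p).
Proof.
move=> Phisig DPhi Dsig csig cV r_inj.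
pose centred f a := [/\ D a, c a = 0 & r a = f].
(* [T] consists of the codes realised by centred particles, and [e] below chooses a particle for
   each. *)
pose p f := `[< exists a, centred f a >]; pose T : finType := {f : F | p f}.
have /choice[e eP] : forall x : T, exists a, centred (val x) a.
  by move=> x; exact/asboolP/(valP x).
have e_inj x y : e x = e y -> x = y.
  move=> exy; apply: val_inj.
  by have [[_ _ <-] [_ _ <-]] := (eP x, eP y); rewrite exy.
have e_surj a : D a -> exists x, a = sigmaz (- c a) (e x).
  move=> Da; have cena : centred (r (sigmaz (c a) a)) (sigmaz (c a) a).
    by split=> //; [exact: Dsig | rewrite csig ?subrr].
  have [x xE] : exists x : T, val x = r (sigmaz (c a) a).
    have rT : p (r (sigmaz (c a) a)).
      by apply/asboolP; exists (sigmaz (c a) a).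
    by exists (exist (fun f => is_true (p f)) _ rT).
  exists x; have [De ce re] := eP x; have [Da' ca' _] := cena.
  rewrite (r_inj (e x) (sigmaz (c a) a)) ?re//.
  by rewrite sigmazD addNr sigmaz0.
have De x : D (e x) by case: (eP x).
have ce x : c (e x) = 0 by case: (eP x).
(* [xi x] is the code of the image of [e x] after recentring. *)
have /choice[xi xiE] x := e_surj (Phi (e x)) (DPhi _ (De x)).
exists T, xi, (fun x => c (Phi (e x)) - c (e x)); split=> [x|]; first exact: cV.
(* [sigmaz k] lowers the centre by [k], so the minus sign puts the centre at [p.2]. *)
exists (fun p => sigmaz (- p.2) (e p.1)); split; last first.
  by move=> [x z]; rewrite Phisig xiE sigmazD /= ce subr0 opprD.
split.
- by move=> [x z] _; exact: Dsig.
- move=> [x z] [y t] _ _ /= xy.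
  have zt : z = t.
    by have := congr1 c xy; rewrite !csig// !ce !sub0r !opprK.
  rewrite zt in xy *; congr pair; apply: e_inj.
  by have := congr1 (sigmaz t) xy; rewrite !sigmazD subrr !sigmaz0.
- move=> a Da; have [x ax] := e_surj a Da.
  by exists (x, c a).
Qed.

End Shifts.

Theorem theorem2p1 (A : finType) (Phi : config A -> config A)
    (X L R : set (config A)) (W : nat)
    (hPhi : nearest_neighbour_ca Phi)
    (hX : subshift X) (hXM : markov_subshift X) (hXPhi : ca_invariant Phi X)
    (hL : subshift L) (hLX : L `<=` X)
    (hLper : sigma_periodic L) (hLtr : sigma_transitive Phi L)
    (hR : subshift R) (hRX : R `<=` X)
    (hRper : sigma_periodic R) (hRtr : sigma_transitive Phi R) :
  let l := left_radius W in
  let m := right_radius W in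
  let D := defect_particles Phi X L R W in
  exists (T : finType) (xi : T -> T) (V : T -> int),
    (forall x, - l - 2 <= V x <= m + 1) /\
    exists Psi : T * int -> config A,
      set_bij [set: T * int] D Psi /\
      forall p, Phi (Psi p) = Psi (skew_translation xi V p).
Proof.
move=> l m D; have [PL PL0 LP] := hLper; have [PR PR0 RP] := hRper.
(* A common period of [L] and [R]. *)
pose P := (PL * PR)%N; have P0 : (0 < P)%N by rewrite muln_gt0 PL0.
have {}LP s : L s -> iter P (@sigma A) s = s.
  by move=> /LP sP; rewrite /P mulnC iterM iter_fix.
have {}RP s : R s -> iter P (@sigma A) s = s.
  by move=> /RP sP; rewrite /P iterM iter_fix.
pose N := (W + P)%N.
(* The code is the restriction to the [2N + 1] sites from [-N] to [N], the window required by
   [centred_particle_eq]. *)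
pose r (a : config A) := [ffun i : 'I_(N + N).+1 => (a (i%:Z - N%:Z) : A)].
apply: (@skew_translation_conjugacy _ _ D (centre X)
    [set v | - l - 2 <= v <= m + 1] _ r).
- by move=> k a; exact: ca_sigmaz.
- exact: defect_particles_ca.
- by move=> k a; exact: defect_particles_sigmaz.
- move=> k a Da; have [i [j [sd _ _ _ _]]] := Da 0.
  by rewrite (centreE sd) (centreE (single_defect_sigmaz k sd)) defect_centreB.
- by move=> a; exact: centre_ca_bounds.
move=> a b Da ca Db cb rab; apply: (centred_particle_eq P0 LP RP Da ca Db cb).
move=> j hj; have jN : (absz (j + N%:Z)%R < (N + N).+1)%N by rewrite /N; lia.
have := congr1 (fun f : {ffun _ -> A} => f (Ordinal jN)) rab.
by rewrite !ffunE /= (_ : _ - _ = j) // /N; lia.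
Qed.
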